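(* Let $(\Sigma,\alpha)$ and $(\Sigma,\omega)$ be an $R$-Cartan structure and an $(I,0,K)$-generalized Finsler structure on the 3-manifold $\Sigma$, respectively. Let also $m$ (nowhere vanishing) and $f$ (positive) be two smooth functions on $\Sigma$ such that they are invariant under the flow of $\hat e_1$ and such that the conditions $$m_{21}=\frac{f_1m_2+f_2m_1}{f}$$ and $$R-f^2=\frac{f_{11}+f_{22}}{f}-\frac{f_1^2+f_2^2}{f^2}-\frac{f_1m_1-f_2m_2}{fm}-\frac{m_{22}}{m}$$ are verified. Then the matrix $$A=\begin{pmatrix}\frac1f\left(\frac fm\right)_2&-\frac{f_1}{fm}&\frac1m\\ \frac fm&0&0\\ 0&f&0\end{pmatrix}$$ gives a coframing change $\omega=A\alpha$ between the $R$-Cartan structure $\alpha$ and the $(I,0,K)$-generalized Finsler structure $\omega$.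
   Context: An $R$-Cartan structure on a 3-manifold $\Sigma$ ($R$ a smooth function) is a coframing $\alpha=(\alpha^1,\alpha^2,\alpha^3)$ with $d\alpha^1=\alpha^2\wedge\alpha^3$, $d\alpha^2=-\alpha^1\wedge\alpha^3$, $d\alpha^3=R\,\alpha^1\wedge\alpha^2$. An $(I,0,K)$-generalized Finsler structure, or generalized Landsberg structure ($I,K$ smooth functions), is a coframing $\omega=(\omega^1,\omega^2,\omega^3)$ with $d\omega^1=-I\omega^1\wedge\omega^3+\omega^2\wedge\omega^3$, $d\omega^2=-\omega^1\wedge\omega^3$, $d\omega^3=K\omega^1\wedge\omega^2$. The frame dual to $\omega$ is denoted $(\hat e_1,\hat e_2,\hat e_3)$. In $\omega=A\alpha$, the coframings $\omega$ and $\alpha$ are regarded as column vectors of one-forms. Subscripts on functions denote directional derivatives with respect to $\alpha$: $dh=h_1\alpha^1+h_2\alpha^2+h_3\alpha^3$ for a smooth function $h$ on $\Sigma$, and $h_{ij}=(h_i)_j$.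
   Formalization: ω is not an arbitrary given (I,0,K)-generalized Finsler structure (for which ω = Aα can fail, e.g. after a constant rotation on SO(3)); ω is defined as Aα, ê_1 is from its dual frame, and one proves that A is invertible and ω is an (I,0,K)-structure for some smooth I, K. *)

(* Defs.v *)
From HB Require Import structures.
From mathcomp Require Import all_boot all_order all_algebra.
From mathcomp Require Import all_classical all_reals all_analysis.

Set Implicit Arguments.
Unset Strict Implicit.
Unset Printing Implicit Defensive.

Import Order.TTheory GRing.Theory Num.Theory.
Import numFieldNormedType.Exports.

Local Open Scope classical_set_scope.
Local Open Scope ring_scope.

Definition i1 : 'I_3 := @Ordinal 3 0 isT.
Definition i2 : 'I_3 := @Ordinal 3 1 isT.
Definition i3 : 'I_3 := @Ordinal 3 2 isT.

Definition mx3 (R : Type) (x0 : R) (rows : seq (seq R)) : 'M[R]_3 :=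
  \matrix_(i, j) nth x0 (nth [::] rows i) j.

Section SmoothEuclidean.
Context {R : realType}.

Definition partial (k : 'I_3) (g : 'rV[R]_3 -> R) : 'rV[R]_3 -> R :=
  fun x => 'D_(delta_mx 0 k) g x.

(* [:: k1; ...; kr] is sent to d_k1 ... d_kr g. *)
Definition iter_partial (s : seq 'I_3) (g : 'rV[R]_3 -> R) : 'rV[R]_3 -> R :=
  foldr partial g s.

(* C^infinity on an open set U: all iterated partial derivatives exist and are
   (Frechet) differentiable, hence continuous, at every point of U. *)
Definition smooth_on (U : set 'rV[R]_3) (g : 'rV[R]_3 -> R) : Prop :=
  forall (s : seq 'I_3) (x : 'rV[R]_3), U x -> differentiable (iter_partial s g) x.

End SmoothEuclidean.

Record chart (R : realType) (M : topologicalType) := Chart {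
  dom : set M;
  coord : M -> 'rV[R]_3;
  coordinv : 'rV[R]_3 -> M;
  dom_open : open dom;
  img_open : open (coord @` dom);
  coordK : forall p, dom p -> coordinv (coord p) = p;
  coord_continuous : forall p, dom p -> {for p, continuous coord};
  coordinv_continuous :
    forall p, dom p -> {for coord p, continuous coordinv} }.

Definition img (R : realType) (M : topologicalType) (c : chart R M) :
  set 'rV[R]_3 := coord c @` dom c.

Definition transition (R : realType) (M : topologicalType) (c c' : chart R M) :
  'rV[R]_3 -> 'rV[R]_3 := coord c' \o coordinv c.

(* Smooth 3-manifolds (Hausdorff, second countable) given by an atlas indexed by
   [atlas].  [chart_at] is a choice of a chart around each point; the geometric
   notions below do not depend on it. *)
Record manifold3 (R : realType) := Manifold3 {
  carrier :> topologicalType;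
  manifold_hausdorff : hausdorff_space carrier;
  manifold_second_countable : @second_countable carrier;
  atlas : Type;
  chart_of : atlas -> chart R carrier;
  chart_at : carrier -> atlas;
  chart_atP : forall p, dom (chart_of (chart_at p)) p;
  transition_smooth : forall (c c' : atlas) (k : 'I_3),
    smooth_on (coord (chart_of c) @` (dom (chart_of c) `&` dom (chart_of c')))
      (fun x => transition (chart_of c) (chart_of c') x 0 k) }.

Section Manifold.
Context {R : realType} {S : manifold3 R}.
Implicit Types (c : atlas S) (p : S) (h : S -> R).

Local Notation ch := (@chart_of R S).

Definition smooth h : Prop :=
  forall c, smooth_on (img (ch c)) (h \o coordinv (ch c)).

(* Jacobian at p of the change of coordinates from c to c'.  In MathComp it acts
   on row vectors, so its (k, l) entry is d x'_l / d x_k. *)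
Definition jac c c' p : 'M[R]_3 :=
  jacobian (transition (ch c) (ch c')) (coord (ch c) p).

(* A one-form is given by its column of components in each chart, a vector field
   by its row of components and a two-form by its matrix of components (values
   on pairs of coordinate vector fields).  Components in the chart c are
   meaningful only at points of the domain of c. *)
Definition form1 := atlas S -> S -> 'cV[R]_3.
Definition form2 := atlas S -> S -> 'M[R]_3.
Definition vfield := atlas S -> S -> 'rV[R]_3.

Definition is_form1 (w : form1) : Prop :=
  (forall c c' p, dom (ch c) p -> dom (ch c') p ->
     w c p = jac c c' p *m w c' p) /\
  (forall c (k : 'I_3),
     smooth_on (img (ch c)) (fun x => w c (coordinv (ch c) x) k 0)).

Definition eq_form2 (b b' : form2) : Prop :=
  forall c p, dom (ch c) p -> b c p = b' c p.

Definition scale2 h (b : form2) : form2 := fun c p => h p *: b c p.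
Definition opp2 (b : form2) : form2 := fun c p => - b c p.
Definition add2 (b b' : form2) : form2 := fun c p => b c p + b' c p.

(* (u /\ v)(X, Y) = u(X) v(Y) - u(Y) v(X) *)
Definition wedge (u v : form1) : form2 :=
  fun c p => u c p *m (v c p)^T - v c p *m (u c p)^T.

(* (dw)_kl = d_k w_l - d_l w_k *)
Definition extd (w : form1) : form2 := fun c p =>
  let w_ (l : 'I_3) := fun x => w c (coordinv (ch c) x) l 0 in
  \matrix_(k, l) (partial k (w_ l) (coord (ch c) p)
                  - partial l (w_ k) (coord (ch c) p)).

Definition dfun h : form1 := fun c p =>
  \col_k partial k (h \o coordinv (ch c)) (coord (ch c) p).

Definition cotriple := 'I_3 -> form1.

(* The j-th column consists of the components of a j. *)
Definition comx (a : cotriple) c p : 'M[R]_3 := \matrix_(k, j) a j c p k 0.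

Definition coframing (a : cotriple) : Prop :=
  (forall j, is_form1 (a j)) /\
  (forall c p, dom (ch c) p -> comx a c p \in unitmx).

Definition dual_frame (a : cotriple) (i : 'I_3) : vfield :=
  fun c p => row i (invmx (comx a c p)).

Lemma dual_frameP (a : cotriple) : coframing a ->
  forall c p, dom (ch c) p ->
  forall i j, dual_frame a i c p *m a j c p = ((i == j)%:R)%:M.
Proof.
move=> [_ au] c p cp i j.
apply/matrixP => k l; rewrite !ord1 !mxE eqxx mulr1n.
have /matrixP/(_ i j) := mulVmx (au _ _ cp); rewrite !mxE => <-.
by apply: eq_bigr => n _; rewrite !mxE.
Qed.

(* [dirder a i h] is the function h_i such that dh = sum_i h_i a^i, see
   [dirderP] below. *)
Definition dirder (a : cotriple) (i : 'I_3) h : S -> R := fun p =>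
  (dual_frame a i (chart_at p) p *m dfun h (chart_at p) p) 0 0.

Lemma differentiable_row (g : 'rV[R]_3 -> 'rV[R]_3) x :
  (forall k, differentiable (fun y => g y 0 k) x) -> differentiable g x.
Proof.
move=> gx; rewrite (_ : g = \sum_(k < 3) (fun y => g y 0 k *: delta_mx 0 k)).
  by apply: differentiable_sum => k; exact: differentiableZl.
by apply/funext => y; rewrite fct_sumE [LHS]row_sum_delta.
Qed.

Lemma overlap_nbhs c c' p : dom (ch c) p -> dom (ch c') p ->
  \forall x \near coord (ch c) p,
    img (ch c) x /\ dom (ch c') (coordinv (ch c) x).
Proof.
move=> cp c'p; near=> x; split; near: x.
  by apply: open_nbhs_nbhs; split; [exact: img_open | exists p].
apply: (coordinv_continuous cp); rewrite (coordK cp).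
by apply: open_nbhs_nbhs; split; [exact: dom_open|].
Unshelve. all: end_near. Qed.

Lemma dfun_transition h : smooth h ->
  forall c c' p, dom (ch c) p -> dom (ch c') p ->
  dfun h c p = jac c c' p *m dfun h c' p.
Proof.
move=> sh c c' p cp c'p.
set x := coord (ch c) p; set T := transition (ch c) (ch c').
have Tx : T x = coord (ch c') p by rewrite /T /transition /= (coordK cp).
have dT : differentiable T x.
  by apply: differentiable_row => k; apply: (transition_smooth _ [::]); exists p.
have dh : differentiable (h \o coordinv (ch c')) (T x).
  by rewrite Tx; apply: (sh c' [::]); exists p.
have dc : differentiable (h \o coordinv (ch c)) x.
  by apply: (sh c [::]); exists p.
have E : {near x, h \o coordinv (ch c) =1 (h \o coordinv (ch c')) \o T}.
  near=> y; rewrite /T /transition /= coordK//.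
  by near: y; apply: filterS (overlap_nbhs cp c'p) => y [].
apply/colP => k; rewrite !mxE /partial -/x.
rewrite (near_eq_derive _ E) ?deriveE; last first.
  exact: differentiable_comp.
rewrite diff_comp//= -(deriveE _ dT) deriveEjacobian// -rowE.
rewrite (row_sum_delta (row k _)) linear_sum; apply: eq_bigr => l _.
rewrite linearZ /= mxE; congr (_ * _).
by rewrite -deriveE // Tx !mxE.
Unshelve. all: end_near. Qed.

Lemma dirderP (a : cotriple) h : coframing a -> smooth h ->
  forall c p, dom (ch c) p ->
  dfun h c p = \sum_i dirder a i h p *: a i c p.
Proof.
move=> [fa au] sh c p cp; set c' := chart_at p.
have c'p : dom (ch c') p := chart_atP p.
rewrite (dfun_transition sh cp c'p) -(mulKVmx (au _ _ c'p) (dfun h c' p)).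
have J : jac c c' p *m comx a c' p = comx a c p.
  apply/matrixP => k j; rewrite [LHS]mxE [RHS]mxE ((fa j).1 c c' p cp c'p).
  by rewrite [RHS]mxE; apply: eq_bigr => l _; rewrite [comx _ _ _ _ _]mxE.
rewrite [LHS]mulmxA J.
apply/colP => k; rewrite summxE mxE; apply: eq_bigr => i _.
rewrite mxE [RHS]mxE mulrC; congr (_ * _).
by rewrite /dirder /dual_frame -row_mul [RHS]mxE.
Qed.

Definition change (A : S -> 'M[R]_3) (a : cotriple) : cotriple :=
  fun i c p => \sum_j A p i j *: a j c p.

Definition cartan_structure (Rc : S -> R) (a : cotriple) : Prop :=
  [/\ smooth Rc, coframing a &
   [/\ eq_form2 (extd (a i1)) (wedge (a i2) (a i3)),
       eq_form2 (extd (a i2)) (opp2 (wedge (a i1) (a i3))) &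
       eq_form2 (extd (a i3)) (scale2 Rc (wedge (a i1) (a i2)))]].

(* (I,0,K)-generalized Finsler structures *)
Definition landsberg_structure (I K : S -> R) (w : cotriple) : Prop :=
  [/\ smooth I, smooth K, coframing w &
   [/\ eq_form2 (extd (w i1))
         (add2 (opp2 (scale2 I (wedge (w i1) (w i3)))) (wedge (w i2) (w i3))),
       eq_form2 (extd (w i2)) (opp2 (wedge (w i1) (w i3))) &
       eq_form2 (extd (w i3)) (scale2 K (wedge (w i1) (w i2)))]].

(* phi is a flow of X, with flow domain D: D is an open neighbourhood of
   {0} x S in R x S meeting each R x {p} in an interval, and the curves
   t |-> phi t p are integral curves of X starting at p.  Maximality of D is not
   required. *)
Definition is_flow (X : vfield) (D : set (R * S)) (phi : R -> S -> S) : Prop :=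
  [/\ open D,
      (forall p, D (0, p) /\ is_interval [set t | D (t, p)]),
      (forall p, phi 0 p = p) &
      forall t p, D (t, p) ->
        {for t, continuous (phi ^~ p)} /\
        forall c, dom (ch c) (phi t p) ->
          is_derive t 1 (fun s => coord (ch c) (phi s p)) (X c (phi t p))].

Definition flow_invariant (D : set (R * S)) (phi : R -> S -> S) h : Prop :=
  forall t p, D (t, p) -> h (phi t p) = h p.

End Manifold.

Arguments form1 {R} S.
Arguments form2 {R} S.
Arguments vfield {R} S.
Arguments cotriple {R} S.

(* Main.v *)
Require Import Defs.
From mathcomp Require Import all_boot all_order all_algebra.
From mathcomp Require Import all_classical all_reals all_analysis.
From mathcomp Require Import ring.

Import Order.TTheory GRing.Theory Num.Theory.
Import numFieldNormedType.Exports.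

Local Open Scope classical_set_scope.
Local Open Scope ring_scope.

Set Implicit Arguments.
Unset Strict Implicit.
Unset Printing Implicit Defensive.

(** Write d_1, d_2, d_3 for the directional derivatives along the frame dual to
[alpha] and h_i for d_i h.  The first row (P, Q, 1/m) of [A] and its two other
rows show that the vector field dual to the first form of [omega] is m times
the third vector of the frame dual to [alpha] ([change_dual_frame]).
Invariance of m and f under its flow therefore means d_3 m = d_3 f = 0: along an
integral curve a chart expression of the function is constant, and the chain
rule turns this into a derivative in the direction of the field
([flow_invariant_dfun]).

Everything else is the computation of d omega in the basis
alpha^1/\alpha^2, alpha^1/\alpha^3, alpha^2/\alpha^3 of two-forms.  For a
combination of the alpha^j with function coefficients it is given by
[cartan_extd]; applied to dh, where d(dh) = 0, that formula yields the
commutators of the d_i ([cartan_commutators]), and for a function with d_3 h = 0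
they say d_3 d_1 h = - d_2 h and d_3 d_2 h = d_1 h.  These two rules, together
with d_3 m = d_3 f = 0, remove all derivatives in the third direction.

Comparing coefficients then forces K = m^2 from d omega^3 and
I = - 2 m_2 / (m f) from the alpha^2/\alpha^3 part of d omega^1.  The remaining
coefficients of the structure equations agree identically, except for the
alpha^1/\alpha^2 part of d omega^1, the only one in which Rc occurs; its equality
is precisely the last hypothesis, an expression for Rc - f^2 ([curvature_identity]).

Two analytic facts carry this.  That d(dh) = 0 is the symmetry of second
derivatives ([derive_comm]), obtained by evaluating the second difference of a
function over a small square in both orders by the mean value theorem.  That I,
K and the forms of [omega] are smooth follows from the closure of smooth
functions under the field operations and under the d_i ([smooth_alg_smooth_on],
[smooth_dirder]). *)

(** * Symmetry of second derivatives *)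

(** Chain rule along a curve, stated with directional derivatives because flows
and partial derivatives are both given by them. *)
Lemma is_derive_curve (R : realType) (V : normedModType R) (g : V -> R)
    (gam : R -> V) (s : R) (v : V) :
  is_derive s 1 gam v -> differentiable g (gam s) ->
  is_derive s 1 (g \o gam) ('D_v g (gam s)).
Proof.
move=> dgam dg.
have /derivable1_diffP dd : derivable gam s 1 by exact: ex_derive.
apply: DeriveDef; first exact/diff_derivable/differentiable_comp.
rewrite deriveE; last exact: differentiable_comp.
by rewrite diff_comp//= -(deriveE _ dd) (@derive_val _ _ _ _ _ _ _ dgam) deriveE.
Qed.

Lemma is_derive_line (R : realType) (V : normedModType R) (y u : V) (s : R) :
  is_derive s 1 (fun t => y + t *: u) u.
Proof.
have d : differentiable ( *:%R^~ u : R -> V) s by exact: ex_diff.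
have -> : (fun t => y + t *: u) = cst y + *:%R^~ u by [].
have dv : is_derive s 1 ( *:%R^~ u : R -> V) u.
  apply: DeriveDef; first exact: diff_derivable.
  by rewrite deriveE// diff_val scale1r.
by have := is_deriveD (is_derive_cst y s (1 : R)) dv; rewrite add0r.
Qed.

Lemma MVT_line (R : realType) (V : normedModType R) (g : V -> R)
    (y u : V) (h : R) : 0 <= h ->
  (forall s, 0 <= s <= h -> differentiable g (y + s *: u)) ->
  exists2 c, 0 <= c <= h & g (y + h *: u) - g y = h * 'D_u g (y + c *: u).
Proof.
move=> h0 dg.
have gd s : 0 <= s <= h ->
    is_derive s 1 (fun t => g (y + t *: u)) ('D_u g (y + s *: u)).
  by move=> /dg; apply: is_derive_curve; exact: is_derive_line.
have gc : {within `[0, h], continuous (fun t => g (y + t *: u))}.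
  apply: derivable_within_continuous => s; rewrite in_itv/= => /gd sd.
  exact: ex_derive.
have gd' s : s \in `]0, h[ ->
    is_derive s 1 (fun t => g (y + t *: u)) ('D_u g (y + s *: u)).
  by rewrite in_itv/= => /andP[s0 sh]; apply: gd; rewrite !ltW.
have [c ch E] := MVT_segment h0 gd' gc.
exists c; first by rewrite in_itv in ch.
by rewrite mulrC -[in RHS](subr0 h) -E scale0r addr0.
Qed.

(** The second difference over a square does not depend on the order of the two
directions, whereas the right-hand side does: this is what makes the mixed
derivatives comparable. *)
Lemma MVT_square (R : realType) (V : normedModType R) (g : V -> R)
    (x u v : V) (h : R) : 0 <= h ->
  (forall s t, 0 <= s <= h -> 0 <= t <= h ->
     differentiable g (x + s *: u + t *: v) /\
     differentiable ('D_u g) (x + s *: u + t *: v)) ->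
  exists s t, [/\ 0 <= s <= h, 0 <= t <= h &
    g (x + h *: u + h *: v) - g (x + h *: u) - g (x + h *: v) + g x =
    h * (h * 'D_v ('D_u g) (x + s *: u + t *: v))].
Proof.
move=> h0 dg.
have h0h : 0 <= h <= h by rewrite h0 lexx.
have h00 : 0 <= (0 : R) <= h by rewrite h0 lexx.
pose g' y := g (y + h *: v) - g y.
have dgs s : 0 <= s <= h -> differentiable (g \o shift (h *: v)) (x + s *: u).
  move=> sh; apply: differentiable_comp => //.
  by have [] := dg s h sh h0h.
have dg0 s : 0 <= s <= h -> differentiable g (x + s *: u).
  by move=> sh; have [] := dg s 0 sh h00; rewrite scale0r addr0.
have [|s sh Es] := @MVT_line R V g' x u h h0.
  by move=> s sh; apply: (@differentiableB _ _ _ (g \o shift (h *: v))); auto.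
have [|t th Et] := @MVT_line R V ('D_u g) (x + s *: u) v h h0.
  by move=> t th; have [] := dg s t sh th.
exists s, t; split => //; rewrite -Et.
have -> : 'D_u g (x + s *: u + h *: v) - 'D_u g (x + s *: u) =
    'D_u g' (x + s *: u).
  rewrite [RHS](@deriveB _ _ _ (g \o shift (h *: v)) g);
    [|by apply: diff_derivable; exact: dgs|by apply: diff_derivable; exact: dg0].
  congr (_ - _); rewrite /derive; set F := (fun k => _); set G := (fun k => _).
  by suff -> : F = G by []; apply/funext => k; rewrite /F /G /= addrA.
by rewrite -Es /g'; ring.
Qed.

(** On squares with vanishing side the two mean value expressions of the second
difference have equal values and tend, by continuity, to the two mixed
derivatives. *)
Lemma derive_comm (R : realType) (V : normedModType R) (g : V -> R)
    (x u v : V) :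
  (\forall y \near x, [/\ differentiable g y, differentiable ('D_u g) y &
                          differentiable ('D_v g) y]) ->
  {for x, continuous ('D_v ('D_u g))} -> {for x, continuous ('D_u ('D_v g))} ->
  'D_v ('D_u g) x = 'D_u ('D_v g) x.
Proof.
move=> dg /cvgrPdist_lt cuv /cvgrPdist_lt cvu.
apply/eqP; rewrite -subr_eq0 -normr_le0; apply/ler_addgt0Pr => e e0; rewrite add0r.
have e20 : 0 < e / 2 by rewrite divr_gt0.
have [r /= r0 xr] : nbhs_ball x [set y |
    [/\ differentiable g y, differentiable ('D_u g) y & differentiable ('D_v g) y]
    /\ `|'D_v ('D_u g) x - 'D_v ('D_u g) y| < e / 2
    /\ `|'D_u ('D_v g) x - 'D_u ('D_v g) y| < e / 2].
  by apply/nbhs_ballP; apply: filterI dg (filterI (cuv _ e20) (cvu _ e20)).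
(* With this side the whole square stays in the ball of radius r. *)
pose h := r / (1 + `|u| + `|v|).
have n0 : 0 < 1 + `|u| + `|v| by rewrite -addrA ltr_pwDl.
have h0 : 0 < h by rewrite divr_gt0.
have hn0 : h != 0 by rewrite gt_eqF.
have inb s t : 0 <= s <= h -> 0 <= t <= h -> ball x r (x + s *: u + t *: v).
  move=> /andP[s0 sh] /andP[t0 th]; rewrite -ball_normE/= -addrA opprD addNKr.
  rewrite normrN (le_lt_trans (ler_normD _ _))// !normrZ !ger0_norm//.
  have -> : r = h + h * `|u| + h * `|v|.
    by rewrite /h; field; rewrite gt_eqF.
  by rewrite -addrA ltr_pwDl// lerD// ler_wpM2r.
have [|s1 [t1 [sh th E1]]] := @MVT_square R V g x u v h (ltW h0).
  by move=> s t sh th; have [[]] := xr _ (inb s t sh th).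
have swap s t : x + t *: v + s *: u = x + s *: u + t *: v by rewrite addrAC.
have [|t [s [th' sh' E2]]] := @MVT_square R V g x v u h (ltW h0).
  by move=> t' s' th' sh'; rewrite swap; have [[]] := xr _ (inb s' t' sh' th').
have /xr[_ [/= A _]] := inb s1 t1 sh th.
have /xr[_ [_ /= B]] := inb s t sh' th'.
rewrite !swap in E2.
have same (a b c d p q : R) :
    a - b - c + d = h * (h * p) -> a - c - b + d = h * (h * q) -> p = q.
  move=> Ep Eq; apply: (mulfI hn0); apply: (mulfI hn0).
  by rewrite -Ep -Eq; ring.
rewrite (same _ _ _ _ _ _ E1 E2) in A.
have close (a b c : R) : `|a - c| < e / 2 -> `|b - c| < e / 2 -> `|a - b| <= e.
  move=> ac bc; apply: (le_trans (ler_distD c a b)).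
  by rewrite [e]splitr lerD ?ltW// distrC.
exact: close A B.
Qed.

(** * Smooth functions on open sets *)

Lemma near_eq_differentiable (R : realType) (V W : normedModType R)
    (f g : V -> W) (x : V) :
  {near x, f =1 g} -> differentiable f x -> differentiable g x.
Proof.
move=> fg df; have fgx : f x = g x := nbhs_singleton fg.
have [dfc dfo] := (diff_locallyP x f).1 df.
have dgo : g \o shift x = cst (g x) + 'd f x +o_ (0 : V) id.
  apply/eqaddoP => e e0; have /eqaddoP/(_ e e0) dfe := dfo.
  have fg0 : \forall h \near (0 : V), f (h + x) = g (h + x).
    have fg' : \forall y \near x, f y = g y by exact: fg.
    rewrite (near_shift 0 x) subr0 in fg'. exact: fg'.
  apply: filterS2 fg0 dfe => h /= E.
  by rewrite -fgx !fctE /= E.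
by apply/diff_locallyP; rewrite (diff_unique dfc dgo).
Qed.

Section SmoothOn.
Context {R : realType}.
Implicit Types (U : set 'rV[R]_3) (g : 'rV[R]_3 -> R).

Lemma near_eq_partial k g g' x : {near x, g =1 g'} -> partial k g x = partial k g' x.
Proof. by move=> gg'; rewrite /partial (near_eq_derive _ gg'). Qed.

Lemma eq_on_near U g g' x : open U -> {in U, g =1 g'} -> U x -> {near x, g =1 g'}.
Proof.
move=> oU gg' Ux; apply: filterS (open_nbhs_nbhs (conj oU Ux)) => y Uy.
by apply: gg'; rewrite inE.
Qed.

(** An iterated derivative of a product or of an inverse mixes sums, products and
inverses of derivatives, so all the operations are treated at once.  The class
is closed under them by construction and under partial derivatives by the
Leibniz rule; as its members are differentiable, they are smooth. *)
Inductive smooth_alg U : ('rV[R]_3 -> R) -> Prop :=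
| SAsmooth g : smooth_on U g -> smooth_alg U g
| SAcst a : smooth_alg U (cst a)
| SAadd g h : smooth_alg U g -> smooth_alg U h -> smooth_alg U (fun x => g x + h x)
| SAmul g h : smooth_alg U g -> smooth_alg U h -> smooth_alg U (fun x => g x * h x)
| SAinv g : smooth_alg U g -> (forall x, U x -> g x != 0) ->
    smooth_alg U (fun x => (g x)^-1).

Lemma smooth_alg_differentiable U g x :
  smooth_alg U g -> U x -> differentiable g x.
Proof.
elim=> {g} [g sg|a|g h _ dg _ dh|g h _ dg _ dh|g _ dg gn0] Ux.
- exact: (sg [::]).
- exact: differentiable_cst.
- by apply: differentiableD; auto.
- by apply: differentiableM; auto.
- by apply: differentiableV; auto.
Qed.

Lemma smooth_alg_partial U g k : smooth_alg U g ->
  exists2 g', smooth_alg U g' & {in U, partial k g =1 g'}.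
Proof.
have der g' x : smooth_alg U g' -> x \in U -> derivable g' x (delta_mx 0 k).
  rewrite inE => sg Ux; apply: diff_derivable.
  exact: smooth_alg_differentiable sg Ux.
elim=> {g} [g sg|a|g h sg [g' sg' gg'] sh [h' sh' hh']
           |g h sg [g' sg' gg'] sh [h' sh' hh']|g sg [g' sg' gg'] gn0].
- exists (partial k g) => //; apply: SAsmooth => s x Ux.
  by have := sg (rcons s k) x Ux; rewrite /iter_partial foldr_rcons.
- by exists (cst 0) => [|x _]; [exact: SAcst|rewrite /partial derive_cst].
- exists (fun x => g' x + h' x) => [|x Ux]; first exact: SAadd.
  by rewrite /partial [LHS]deriveD; [rewrite -gg'// -hh'|exact: der|exact: der].
- exists (fun x => g x * h' x + h x * g' x) => [|x Ux].
    by apply: SAadd; exact: SAmul.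
  by rewrite /partial [LHS]deriveM; [rewrite -gg'// -hh'|exact: der|exact: der].
- exists (fun x => cst (- 1) x * ((g x)^-1 * (g x)^-1) * g' x) => [|x Ux].
    apply: SAmul => //; apply: SAmul; first exact: SAcst.
    by apply: SAmul; exact: SAinv.
  rewrite /partial [LHS]deriveV; [|by apply: gn0; rewrite inE in Ux|exact: der].
  by rewrite -gg'// mulN1r expr2 invfM.
Qed.

Lemma smooth_alg_smooth_on U g : open U -> smooth_alg U g -> smooth_on U g.
Proof.
move=> oU sg s x Ux.
suff [g' sg' gg'] : exists2 g', smooth_alg U g' & {in U, iter_partial s g =1 g'}.
  apply: (@near_eq_differentiable _ _ _ g').
    by apply: (@eq_on_near U) => // y Uy; rewrite gg'.
  exact: smooth_alg_differentiable sg' Ux.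
elim: s {x Ux} => [|k s [g' sg' gg']]; first by exists g.
have [h sh gh] := smooth_alg_partial k sg'.
exists h => // x Ux; rewrite -gh//=; apply: near_eq_partial.
by apply: eq_on_near gg' _; rewrite // inE in Ux.
Qed.

(** Only values on the open set matter; outside of it chart expressions of
functions on a manifold are arbitrary. *)
Lemma smooth_on_eq U g g' : open U -> {in U, g =1 g'} ->
  smooth_on U g -> smooth_on U g'.
Proof.
move=> oU gg' sg s x Ux.
apply: near_eq_differentiable (sg s x Ux).
apply: eq_on_near (Ux) => //; elim: s => [|k s IH] //= y Uy.
by apply: near_eq_partial; apply: eq_on_near IH _; rewrite // inE in Uy.
Qed.

Lemma smooth_onD U g h : open U -> smooth_on U g -> smooth_on U h ->
  smooth_on U (fun x => g x + h x).
Proof.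
by move=> oU sg sh; apply: smooth_alg_smooth_on => //; apply: SAadd; exact: SAsmooth.
Qed.

Lemma smooth_onM U g h : open U -> smooth_on U g -> smooth_on U h ->
  smooth_on U (fun x => g x * h x).
Proof.
by move=> oU sg sh; apply: smooth_alg_smooth_on => //; apply: SAmul; exact: SAsmooth.
Qed.

Lemma smooth_onV U g : open U -> (forall x, U x -> g x != 0) -> smooth_on U g ->
  smooth_on U (fun x => (g x)^-1).
Proof.
move=> oU gn0 sg; apply: smooth_alg_smooth_on => //.
by apply: SAinv => //; exact: SAsmooth.
Qed.

Lemma smooth_on_cst U (a : R) : open U -> smooth_on U (fun=> a).
Proof. by move=> oU; apply: smooth_alg_smooth_on => //; exact: SAcst. Qed.

Lemma smooth_on_sum U (I : Type) (r : seq I) (P : pred I) (F : I -> 'rV[R]_3 -> R) :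
  open U -> (forall i, P i -> smooth_on U (F i)) ->
  smooth_on U (fun x => \sum_(i <- r | P i) F i x).
Proof.
move=> oU sF; rewrite (_ : (fun _ => _) = \sum_(i <- r | P i) F i); last first.
  by apply/funext => x; rewrite fct_sumE.
apply: big_ind => //; [exact: smooth_on_cst|by move=> *; exact: smooth_onD].
Qed.

Lemma smooth_on_prod U (I : Type) (r : seq I) (P : pred I) (F : I -> 'rV[R]_3 -> R) :
  open U -> (forall i, P i -> smooth_on U (F i)) ->
  smooth_on U (fun x => \prod_(i <- r | P i) F i x).
Proof.
move=> oU sF; elim: r => [|i r IH].
  by under eq_fun do rewrite big_nil; exact: smooth_on_cst.
under eq_fun do rewrite big_cons.
by case: (boolP (P i)) => // Pi; apply: smooth_onM; auto.
Qed.

Lemma smooth_on_partial U g k : smooth_on U g -> smooth_on U (partial k g).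
Proof.
move=> sg s x Ux.
by have := sg (rcons s k) x Ux; rewrite /iter_partial foldr_rcons.
Qed.

Lemma smooth_on_det U n (B : 'rV[R]_3 -> 'M[R]_n) : open U ->
  (forall i j, smooth_on U (fun x => B x i j)) -> smooth_on U (fun x => \det (B x)).
Proof.
move=> oU sB; rewrite /determinant; apply: smooth_on_sum => // s _.
apply: smooth_onM => //; first exact: smooth_on_cst.
exact: smooth_on_prod.
Qed.

(** Cramer's rule. *)
Lemma smooth_on_invmx U n (B : 'rV[R]_3 -> 'M[R]_n) i j : open U ->
  (forall i j, smooth_on U (fun x => B x i j)) ->
  (forall x, U x -> B x \in unitmx) -> smooth_on U (fun x => invmx (B x) i j).
Proof.
move=> oU sB uB.
apply: (@smooth_on_eq U (fun x => (\det (B x))^-1 * cofactor (B x) j i)) => //.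
  by move=> x; rewrite inE => /uB uBx; rewrite /invmx uBx !mxE.
apply: smooth_onM => //.
  by apply: smooth_onV => // [x /uB|]; [rewrite unitmxE unitfE|exact: smooth_on_det].
apply: smooth_onM => //; first exact: smooth_on_cst.
by apply: smooth_on_det => // k l; under eq_fun do rewrite !mxE; exact: sB.
Qed.

Lemma partial_comm U g k l x : open U -> smooth_on U g -> U x ->
  partial k (partial l g) x = partial l (partial k g) x.
Proof.
move=> oU sg Ux; apply: derive_comm.
- apply: filterS (open_nbhs_nbhs (conj oU Ux)) => y Uy; split.
  + exact: (sg [::]).
  + exact: (sg [:: l]).
  + exact: (sg [:: k]).
- by apply: differentiable_continuous; exact: (sg [:: k; l]).
- by apply: differentiable_continuous; exact: (sg [:: l; k]).
Qed.

End SmoothOn.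

(** * Functions on a manifold and their derivatives along a coframing *)

Lemma ord3P (k : 'I_3) : [\/ k = i1, k = i2 | k = i3].
Proof.
by case: k => [[|[|[|//]]] ?]; [constructor 1|constructor 2|constructor 3];
  exact: val_inj.
Qed.

Lemma sum_ord3 (V : nmodType) (F : 'I_3 -> V) : \sum_i F i = F i1 + F i2 + F i3.
Proof.
rewrite !big_ord_recr big_ord0 /= add0r.
by congr (F _ + F _ + F _); exact: val_inj.
Qed.

Section Forms.
Context {R : realType} {S : manifold3 R}.
Implicit Types (c : atlas S) (p : S) (g h : S -> R) (a : cotriple S).

Local Notation ch := (@chart_of R S).
Local Notation coord := Defs.coord.

Lemma open_img c : open (img (ch c)). Proof. exact: img_open. Qed.
Arguments open_img : clear implicits.

Lemma img_coord c p : dom (ch c) p -> img (ch c) (coord (ch c) p).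
Proof. by move=> cp; exists p. Qed.

Lemma in_imgP c (P : 'rV[R]_3 -> Prop) :
  (forall p, dom (ch c) p -> P (coord (ch c) p)) -> {in img (ch c), forall x, P x}.
Proof. by move=> H x; rewrite inE => -[p cp <-]; exact: H. Qed.

Lemma smoothM g h : smooth g -> smooth h -> smooth (fun p => g p * h p).
Proof. move=> sg sh c; exact (smooth_onM (open_img c) (sg c) (sh c)). Qed.

Lemma smooth_cst (x : R) : smooth (fun _ : S => x).
Proof. by move=> c; exact: smooth_on_cst (open_img c). Qed.

Lemma smoothD g h : smooth g -> smooth h -> smooth (fun p => g p + h p).
Proof. move=> sg sh c; exact (smooth_onD (open_img c) (sg c) (sh c)). Qed.

Lemma smoothN g : smooth g -> smooth (fun p => - g p).
Proof.
move=> sg; rewrite (_ : (fun _ => _) = fun p => -1 * g p).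
  by apply: smoothM => //; exact: smooth_cst.
by apply/funext => p; rewrite mulN1r.
Qed.

Lemma smoothV g : (forall p, g p != 0) -> smooth g -> smooth (fun p => (g p)^-1).
Proof. move=> g0 sg c; exact (smooth_onV (open_img c) (fun x _ => g0 _) (sg c)). Qed.

Lemma smoothB g h : smooth g -> smooth h -> smooth (fun p => g p - h p).
Proof. by move=> sg sh; apply: smoothD => //; exact: smoothN. Qed.

Lemma smooth_div g h : smooth g -> smooth h -> (forall p, h p != 0) ->
  smooth (fun p => g p / h p).
Proof. by move=> sg sh h0; apply: smoothM => //; exact: smoothV. Qed.

Lemma smooth_differentiable h c p : smooth h -> dom (ch c) p ->
  differentiable (h \o coordinv (ch c)) (coord (ch c) p).
Proof. by move=> sh cp; apply: (sh c [::]); exact: img_coord. Qed.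

Lemma smooth_derivable h c p k : smooth h -> dom (ch c) p ->
  derivable (h \o coordinv (ch c)) (coord (ch c) p) (delta_mx 0 k).
Proof. by move=> sh cp; apply: diff_derivable; exact: smooth_differentiable. Qed.

Lemma form1_derivable (w : form1 S) c p k l : is_form1 w -> dom (ch c) p ->
  derivable (fun x => w c (coordinv (ch c) x) l 0) (coord (ch c) p) (delta_mx 0 k).
Proof.
move=> [_ sw] cp; apply: diff_derivable.
by apply: (sw c l [::]); exact: img_coord.
Qed.

(** The definition of [dirder] uses a different chart at each point; smoothness
needs its expression in one fixed chart. *)
Lemma dirder_chart a i h c p : coframing a -> smooth h -> dom (ch c) p ->
  dirder a i h p = (dual_frame a i c p *m dfun h c p) 0 0.
Proof.
move=> ca sh cp; rewrite (dirderP ca sh cp) mulmx_sumr summxE (bigD1 i)//= big1.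
  by rewrite -scalemxAr (dual_frameP ca cp) eqxx !mxE mulr1 addr0.
move=> j ji; rewrite -scalemxAr (dual_frameP ca cp) eq_sym (negPf ji).
by rewrite !mxE mulr0.
Qed.

Lemma smooth_dirder a i h : coframing a -> smooth h -> smooth (dirder a i h).
Proof.
move=> ca sh c.
apply: (@smooth_on_eq _ _ (fun x => \sum_k invmx (comx a c (coordinv (ch c) x)) i k
          * partial k (h \o coordinv (ch c)) x)) (open_img c) _ _.
  apply: in_imgP => p cp /=.
  rewrite coordK// (dirder_chart i ca sh cp) mxE; apply: eq_bigr => k _.
  by rewrite !mxE.
apply: smooth_on_sum (open_img c) _ => k _.
apply: smooth_onM (open_img c) _ _; last exact: smooth_on_partial (sh c).
apply: smooth_on_invmx (open_img c) _ _ => [l j|x [p cp <-]].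
  by under eq_fun do rewrite mxE; exact: (ca.1 j).2.
by rewrite coordK//; exact: ca.2.
Qed.

Lemma dfunM g h c p : smooth g -> smooth h -> dom (ch c) p ->
  dfun (fun q => g q * h q) c p = g p *: dfun h c p + h p *: dfun g c p.
Proof.
move=> sg sh cp; apply/colP => k; rewrite !mxE.
rewrite /partial [LHS](@deriveM _ _ (g \o coordinv (ch c)) (h \o coordinv (ch c)));
  try exact: smooth_derivable.
by rewrite /= coordK.
Qed.

Lemma dfunV g c p : (forall q, g q != 0) -> smooth g -> dom (ch c) p ->
  dfun (fun q => (g q)^-1) c p = - (g p) ^- 2 *: dfun g c p.
Proof.
move=> g0 sg cp; apply/colP => k; rewrite !mxE.
rewrite /partial [LHS](@deriveV _ _ (g \o coordinv (ch c))) //=.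
  by rewrite coordK.
exact: smooth_derivable.
Qed.

Lemma dirderM a i g h p : smooth g -> smooth h ->
  dirder a i (fun q => g q * h q) p = g p * dirder a i h p + h p * dirder a i g p.
Proof.
move=> sg sh; rewrite /dirder dfunM//; last exact: chart_atP.
by rewrite mulmxDr -!scalemxAr !mxE.
Qed.

Lemma dirderV a i g p : (forall q, g q != 0) -> smooth g ->
  dirder a i (fun q => (g q)^-1) p = - (g p) ^- 2 * dirder a i g p.
Proof.
move=> g0 sg; rewrite /dirder dfunV//; last exact: chart_atP.
by rewrite -!scalemxAr !mxE.
Qed.

Lemma dfunD g h c p : smooth g -> smooth h -> dom (ch c) p ->
  dfun (fun q => g q + h q) c p = dfun g c p + dfun h c p.
Proof.
move=> sg sh cp; apply/colP => k; rewrite !mxE /partial.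
by rewrite [LHS](@deriveD _ _ _ (g \o coordinv (ch c)) (h \o coordinv (ch c)));
  try exact: smooth_derivable.
Qed.

Lemma dirderD a i g h p : smooth g -> smooth h ->
  dirder a i (fun q => g q + h q) p = dirder a i g p + dirder a i h p.
Proof.
move=> sg sh; rewrite /dirder dfunD//; last exact: chart_atP.
by rewrite mulmxDr !mxE.
Qed.

Lemma dirder_cst a i (x : R) p : dirder a i (fun=> x) p = 0.
Proof.
rewrite /dirder (_ : dfun _ _ _ = 0) ?mulmx0 ?mxE//.
by apply/colP => k; rewrite !mxE /partial derive_cst.
Qed.

Lemma dirderN a i g p : smooth g ->
  dirder a i (fun q => - g q) p = - dirder a i g p.
Proof.
move=> sg; rewrite (_ : (fun q => - g q) = (fun q => -1 * g q)); last first.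
  by apply/funext => q; rewrite mulN1r.
by rewrite dirderM ?dirder_cst ?mulr0 ?addr0 ?mulN1r//; exact: smooth_cst.
Qed.

Lemma dirderB a i g h p : smooth g -> smooth h ->
  dirder a i (fun q => g q - h q) p = dirder a i g p - dirder a i h p.
Proof. by move=> sg sh; rewrite dirderD ?dirderN//; exact: smoothN. Qed.

Lemma dirder_div a i g h p : (forall q, h q != 0) -> smooth g -> smooth h ->
  dirder a i (fun q => g q / h q) p
  = dirder a i g p / h p - g p * dirder a i h p / h p ^+ 2.
Proof.
move=> h0 sg sh; rewrite dirderM ?dirderV//; last exact: smoothV.
by field; rewrite ?expf_neq0 h0.
Qed.

(** * Exterior derivatives of combinations of a coframing *)

Lemma wedgeE (u v : form1 S) c p k l :
  wedge u v c p k l = u c p k 0 * v c p l 0 - v c p k 0 * u c p l 0.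
Proof. by rewrite !mxE !big_ord1 !mxE. Qed.

Lemma wedgeC (u v : form1 S) c p : wedge u v c p = - wedge v u c p.
Proof. by rewrite /wedge opprB. Qed.

Lemma wedge_diag (u : form1 S) c p : wedge u u c p = 0.
Proof. exact: subrr. Qed.

(** Components in a chart are meaningful on its domain only, so identities between
forms, such as the expansion of dh in a coframing, hold just there; this is
enough for the exterior derivative. *)
Lemma eq_extd (w w' : form1 S) c p : (forall q, dom (ch c) q -> w c q = w' c q) ->
  dom (ch c) p -> extd w c p = extd w' c p.
Proof.
move=> ww' cp.
have E k l : partial k (fun x => w c (coordinv (ch c) x) l 0) (coord (ch c) p)
           = partial k (fun x => w' c (coordinv (ch c) x) l 0) (coord (ch c) p).
  apply: near_eq_partial.
  apply: (eq_on_near (open_img c) _ (img_coord cp)); apply: in_imgP => q cq.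
  by rewrite coordK// ww'.
by apply/matrixP => k l; rewrite !mxE !E.
Qed.

(** Equality of mixed partial derivatives. *)
Lemma extd_dfun h c p : smooth h -> dom (ch c) p -> extd (dfun h) c p = 0.
Proof.
move=> sh cp; apply/matrixP => k l; rewrite !mxE.
have E i j : partial i (fun x => dfun h c (coordinv (ch c) x) j 0) (coord (ch c) p)
    = partial i (partial j (h \o coordinv (ch c))) (coord (ch c) p).
  apply: near_eq_partial.
  apply: (eq_on_near (open_img c) _ (img_coord cp)); apply: in_imgP => q cq.
  by rewrite mxE !coordK.
rewrite !E; apply/eqP; rewrite subr_eq0; apply/eqP.
exact: partial_comm (open_img c) (sh c) (img_coord cp).
Qed.

Lemma extd_comb (n : nat) (h : 'I_n -> S -> R) (w : 'I_n -> form1 S) c p :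
  (forall j, smooth (h j)) -> (forall j, is_form1 (w j)) -> dom (ch c) p ->
  extd (fun c p => \sum_j h j p *: w j c p) c p =
  \sum_j (wedge (dfun (h j)) (w j) c p + h j p *: extd (w j) c p).
Proof.
move=> sh fw cp.
have E k l : partial k (fun x => (\sum_j h j (coordinv (ch c) x) *:
                 w j c (coordinv (ch c) x)) l 0) (coord (ch c) p)
    = \sum_j (h j p * partial k (fun x => w j c (coordinv (ch c) x) l 0)
                        (coord (ch c) p)
              + w j c p l 0 * dfun (h j) c p k 0).
  have -> : (fun x => (\sum_j h j (coordinv (ch c) x) *:
                 w j c (coordinv (ch c) x)) l 0) =
      \sum_j ((h j \o coordinv (ch c)) * (fun x => w j c (coordinv (ch c) x) l 0)).
    apply/funext => x; rewrite summxE fct_sumE; apply: eq_bigr => j _.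
    by rewrite mxE.
  rewrite /partial derive_sum; last first.
    by move=> j; apply: derivableM; [exact: smooth_derivable|exact: form1_derivable].
  apply: eq_bigr => j _; rewrite deriveM;
    [|exact: smooth_derivable|exact: form1_derivable].
  by rewrite /= coordK// mxE.
apply/matrixP => k l; rewrite mxE !E summxE -sumrB; apply: eq_bigr => j _.
by rewrite [in RHS]mxE wedgeE [X in _ = _ + X]mxE [extd _ _ _ _ _]mxE; ring.
Qed.

Lemma wedge_comb (u v : 'I_3 -> S -> R) a c p :
  wedge (fun c p => \sum_j u j p *: a j c p)
        (fun c p => \sum_j v j p *: a j c p) c p =
  (u i1 p * v i2 p - u i2 p * v i1 p) *: wedge (a i1) (a i2) c p
  + (u i1 p * v i3 p - u i3 p * v i1 p) *: wedge (a i1) (a i3) c p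
  + (u i2 p * v i3 p - u i3 p * v i2 p) *: wedge (a i2) (a i3) c p.
Proof.
apply/matrixP => k l.
have E x y z : ((x *: wedge (a i1) (a i2) c p + y *: wedge (a i1) (a i3) c p
              + z *: wedge (a i2) (a i3) c p) : 'M[R]_3) k l
  = x * wedge (a i1) (a i2) c p k l + y * wedge (a i1) (a i3) c p k l
    + z * wedge (a i2) (a i3) c p k l by rewrite !mxE.
by rewrite E !wedgeE !sum_ord3 !mxE; ring.
Qed.

(** Evaluating on pairs of vectors of the dual frame reads off the
coefficients. *)
Lemma wedge_free a c p (x y z : R) : coframing a -> dom (ch c) p ->
  x *: wedge (a i1) (a i2) c p + y *: wedge (a i1) (a i3) c p
  + z *: wedge (a i2) (a i3) c p = 0 -> [/\ x = 0, y = 0 & z = 0].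
Proof.
move=> ca cp W0.
have E i j k l : (dual_frame a i c p *m wedge (a k) (a l) c p
                  *m (dual_frame a j c p)^T) 0 0
    = (i == k)%:R * (j == l)%:R - (i == l)%:R * (j == k)%:R.
  rewrite mulmxBr mulmxBl mxE [X in _ + X]mxE !mulmxA.
  rewrite !(dual_frameP ca cp) -!mulmxA -!trmx_mul !(dual_frameP ca cp).
  by rewrite !mul_scalar_mx !mxE.
have lin (e : 'rV[R]_3) (e' : 'cV[R]_3) (B C D : 'M[R]_3) :
    (e *m (x *: B + y *: C + z *: D) *m e') 0 0
    = x * (e *m B *m e') 0 0 + y * (e *m C *m e') 0 0 + z * (e *m D *m e') 0 0.
  rewrite !mulmxDr !mulmxDl -!scalemxAr -!scalemxAl.
  by move: (e *m B *m e') (e *m C *m e') (e *m D *m e') => *; rewrite !mxE.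
have G i j := lin (dual_frame a i c p) (dual_frame a j c p)^T
  (wedge (a i1) (a i2) c p) (wedge (a i1) (a i3) c p) (wedge (a i2) (a i3) c p).
have {}G i j := etrans (esym (G i j)) (congr1 (fun B =>
  (dual_frame a i c p *m B *m (dual_frame a j c p)^T) 0 0) W0).
by split; [have := G i1 i2|have := G i1 i3|have := G i2 i3];
  rewrite !E !mulmx0 !mul0mx mxE !eqE /=
          !(mulr0, mul0r, mulr1, oppr0, addr0, add0r).
Qed.

Lemma coframing_wedge_dfun a h (w : form1 S) c p : coframing a -> smooth h ->
  dom (ch c) p ->
  wedge (dfun h) w c p = \sum_l dirder a l h p *: wedge (a l) w c p.
Proof.
move=> ca sh cp; rewrite /wedge (dirderP ca sh cp) linear_sum mulmx_suml mulmx_sumr.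
rewrite -sumrB; apply: eq_bigr => l _.
by rewrite linearZ /= -scalemxAl -scalemxAr scalerBr.
Qed.

(** Expand each dh_j in the coframing and each d alpha^j by the structure
equations. *)
Lemma cartan_extd (Rc : S -> R) a (h : 'I_3 -> S -> R) c p :
  cartan_structure Rc a -> (forall j, smooth (h j)) -> dom (ch c) p ->
  let d := dirder a in
  extd (fun c p => \sum_j h j p *: a j c p) c p =
  (d i1 (h i2) p - d i2 (h i1) p + Rc p * h i3 p) *: wedge (a i1) (a i2) c p
  + (d i1 (h i3) p - d i3 (h i1) p - h i2 p) *: wedge (a i1) (a i3) c p
  + (d i2 (h i3) p - d i3 (h i2) p + h i1 p) *: wedge (a i2) (a i3) c p.
Proof.
move=> [_ ca [d1 d2 d3]] sh cp d.
rewrite extd_comb//; last exact: ca.1.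
rewrite sum_ord3 d1// d2// d3// !(coframing_wedge_dfun _ ca)// !sum_ord3 -!/d.
rewrite /scale2 /opp2 !wedge_diag (wedgeC (a i2) (a i1)) (wedgeC (a i3) (a i1)).
rewrite (wedgeC (a i3) (a i2)).
move: (wedge (a i1) (a i2) c p) (wedge (a i1) (a i3) c p) (wedge (a i2) (a i3) c p).
by move=> W12 W13 W23; apply/matrixP => k l; rewrite !mxE; ring.
Qed.

(** These are the coefficients of d(dh) = 0. *)
Lemma cartan_commutators (Rc : S -> R) a h p :
  cartan_structure Rc a -> smooth h ->
  let d := dirder a in
  [/\ d i1 (d i2 h) p - d i2 (d i1 h) p = - (Rc p * d i3 h p),
      d i1 (d i3 h) p - d i3 (d i1 h) p = d i2 h p
    & d i2 (d i3 h) p - d i3 (d i2 h) p = - d i1 h p].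
Proof.
move=> sa sh d; have [_ ca _] := sa.
have cp : dom (ch (chart_at p)) p by exact: chart_atP.
have sd j : smooth (d j h) by exact: smooth_dirder.
have := cartan_extd sa sd cp.
rewrite (_ : extd _ _ _ = 0) => [/esym/(wedge_free ca cp)[E1 E2 E3]|].
  split; last by apply/eqP; rewrite -addr_eq0 E3.
  - by apply/eqP; rewrite -addr_eq0 E1.
  - exact: subr0_eq.
rewrite -(extd_dfun sh cp); apply: eq_extd => // q cq.
by rewrite (dirderP ca sh cq).
Qed.

(** * Flows and changes of coframing *)

Lemma derive_partial (g : 'rV[R]_3 -> R) x v : differentiable g x ->
  'D_v g x = (v *m \col_k partial k g x) 0 0.
Proof.
move=> dg; rewrite deriveE// [v in LHS]row_sum_delta linear_sum mxE.
by apply: eq_bigr => k _; rewrite linearZ /= mxE /partial deriveE.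
Qed.

(** An invariant function is constant on the integral curve through p, so its
derivative at time 0 vanishes. *)
Lemma flow_invariant_dfun (X : vfield S) D phi h c p :
  is_flow X D phi -> flow_invariant D phi h -> smooth h -> dom (ch c) p ->
  (X c p *m dfun h c p) 0 0 = 0.
Proof.
move=> [oD D0 phi0 fX] inv sh cp.
have [cphi dphi] := fX _ _ (D0 p).1.
have /dphi : dom (ch c) (phi 0 p) by rewrite phi0.
rewrite phi0 => dX.
rewrite -derive_partial; last exact: smooth_differentiable.
have dh : is_derive (0 : R) 1 ((h \o coordinv (ch c)) \o (fun s => coord (ch c) (phi s p)))
    ('D_(X c p) (h \o coordinv (ch c)) (coord (ch c) p)).
  by rewrite -[in X in is_derive _ _ _ X](phi0 p); apply: is_derive_curve;
    rewrite phi0//; exact: smooth_differentiable.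
rewrite -(@derive_val _ _ _ _ _ _ _ dh) -[RHS](derive_cst (h p) (0 : R) 1).
apply: near_eq_derive; near=> s => /=; rewrite coordK.
  rewrite inv//; near: s.
  have : \forall z \near ((0 : R), p), D z.
    exact: open_nbhs_nbhs (conj oD (D0 p).1).
  move=> [[A B] /= [A0 Bp] AB]; apply: filterS A0 => s As.
  by apply: AB; split => //=; exact: nbhs_singleton.
near: s; apply: cphi; rewrite phi0; apply: open_nbhs_nbhs; split => //.
exact: dom_open.
Unshelve. all: end_near. Qed.

Lemma is_form1_comb (n : nat) (h : 'I_n -> S -> R) (w : 'I_n -> form1 S) :
  (forall j, smooth (h j)) -> (forall j, is_form1 (w j)) ->
  is_form1 (fun c p => \sum_j h j p *: w j c p).
Proof.
move=> sh fw; split=> [c c' p cp c'p|c k].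
  rewrite mulmx_sumr; apply: eq_bigr => j _.
  by rewrite -scalemxAr ((fw j).1 c c').
under eq_fun do rewrite summxE.
apply: smooth_on_sum (open_img c) _ => j _; under eq_fun do rewrite mxE.
exact: smooth_onM (open_img c) (sh j c) ((fw j).2 c k).
Qed.

Lemma comx_change (A : S -> 'M[R]_3) a c p :
  comx (change A a) c p = comx a c p *m (A p)^T.
Proof.
apply/matrixP => k i; rewrite !mxE summxE; apply: eq_bigr => j _.
by rewrite !mxE mulrC.
Qed.

Lemma change_coframing (A : S -> 'M[R]_3) a : coframing a ->
  (forall i j, smooth (fun p => A p i j)) -> (forall p, A p \in unitmx) ->
  coframing (change A a).
Proof.
move=> [fa ua] sA uA; split=> [i|c p cp]; first exact: is_form1_comb.
by rewrite comx_change unitmx_mul (ua _ _ cp) unitmx_tr uA.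
Qed.

(** The vector with coordinates v in the old dual frame pairs with the new
coframing to v A^T; this identifies one vector of the new dual frame without
inverting A. *)
Lemma change_dual_frame (A : S -> 'M[R]_3) a i (v : 'rV[R]_3) c p :
  coframing a -> A p \in unitmx -> dom (ch c) p ->
  v *m (A p)^T = delta_mx 0 i ->
  dual_frame (change A a) i c p = \sum_j v 0 j *: dual_frame a j c p.
Proof.
move=> [_ ua] uA cp vA; have ua' := ua _ _ cp.
have -> : \sum_j v 0 j *: dual_frame a j c p = v *m invmx (comx a c p).
  by rewrite mulmx_sum_row.
have u : comx a c p *m (A p)^T \in unitmx by rewrite unitmx_mul ua' unitmx_tr uA.
apply: (can_inj (mulmxK u)).
rewrite /dual_frame comx_change -row_mul mulVmx// mulmxA mulmxKV// vA.
by rewrite rowE mulmx1.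
Qed.

End Forms.

(** * Cartan structures and the coframing change *)

(** The last two commutators express every derivative along the third vector that
occurs in d omega through derivatives along the first two. *)
Lemma cartan_invariant_commutators (R : realType) (S : manifold3 R)
    (Rc : S -> R) (a : cotriple S) (h : S -> R) :
  cartan_structure Rc a -> smooth h -> (forall p, dirder a i3 h p = 0) ->
  forall p, dirder a i3 (dirder a i1 h) p = - dirder a i2 h p /\
            dirder a i3 (dirder a i2 h) p = dirder a i1 h p.
Proof.
move=> sa sh h3 p; have [_] := cartan_commutators p sa sh.
have -> : dirder a i3 h = fun=> 0 by apply/funext.
by rewrite !dirder_cst !sub0r => <- /oppr_inj ->; rewrite opprK.
Qed.

(** The alpha^1/\alpha^2 coefficient of d omega^1.  Here f1, m2, f11, ... stand
for the derivatives of f and m, and the second summand of the last left-hand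
factor stands for Rc - f^2. *)
Lemma curvature_identity (F : fieldType) (f m f1 f2 m1 m2 f11 f22 m22 : F) :
  f != 0 -> m != 0 ->
  - (f11 / (f * m) - f1 * (f * m1 + m * f1) / (f * m) ^+ 2)
  - (f22 / (f * m) - f2 * (f * m2 + m * f2) / (f * m) ^+ 2
     - (m22 / (m * m) - m2 * (m * m2 + m * m2) / (m * m) ^+ 2))
  + (f ^+ 2 + ((f11 + f22) / f - (f1 ^+ 2 + f2 ^+ 2) / f ^+ 2
     - (f1 * m1 - f2 * m2) / (f * m) - m22 / m)) * m^-1
  = f ^+ 2 / m - - 2 * m2 / (m * f) * (f * (f2 / (f * m) - m2 / (m * m))).
Proof. by move=> f0 m0; field; rewrite f0 m0. Qed.

Unset Implicit Arguments.

Theorem proposition4p4 (R : realType) (Sigma : manifold3 R)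
    (alpha : cotriple Sigma) (Rc m f : Sigma -> R)
    (D : set (R * Sigma)) (phi : R -> Sigma -> Sigma) :
  let d := dirder alpha in
  let A := fun p : Sigma => mx3 0
    [:: [:: (f p)^-1 * d i2 (fun q => f q / m q) p;
            - (d i1 f p / (f p * m p));
            (m p)^-1];
        [:: f p / m p; 0; 0];
        [:: 0; f p; 0]] in
  let omega := change A alpha in
  cartan_structure Rc alpha ->
  smooth m -> (forall p, m p != 0) ->
  smooth f -> (forall p, 0 < f p) ->
  is_flow (dual_frame omega i1) D phi ->
  flow_invariant D phi m -> flow_invariant D phi f ->
  (forall p, d i1 (d i2 m) p = (d i1 f p * d i2 m p + d i2 f p * d i1 m p) / f p) ->
  (forall p, Rc p - f p ^+ 2 =
     (d i1 (d i1 f) p + d i2 (d i2 f) p) / f p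
     - (d i1 f p ^+ 2 + d i2 f p ^+ 2) / f p ^+ 2
     - (d i1 f p * d i1 m p - d i2 f p * d i2 m p) / (f p * m p)
     - d i2 (d i2 m) p / m p) ->
  (forall p, A p \in unitmx) /\
  exists I K : Sigma -> R, landsberg_structure I K omega.
Proof.
move=> d A omega sa sm m0 sf fpos flow invm invf _ HR.
have f0 p : f p != 0 by rewrite gt_eqF.
have [_ ca _] := sa.
pose P p := d i2 f p / (f p * m p) - d i2 m p / (m p * m p).
pose Q p := - (d i1 f p / (f p * m p)).
have A11 p : A p i1 i1 = P p.
  rewrite mxE /= /d dirder_div// /P -/d.
  by field; rewrite f0 m0.
have A12 p : A p i1 i2 = Q p by rewrite mxE.
have A13 p : A p i1 i3 = (m p)^-1 by rewrite mxE.
have A21 p : A p i2 i1 = f p / m p by rewrite mxE.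
have A22 p : A p i2 i2 = 0 by rewrite mxE.
have A23 p : A p i2 i3 = 0 by rewrite mxE.
have A31 p : A p i3 i1 = 0 by rewrite mxE.
have A32 p : A p i3 i2 = f p by rewrite mxE.
have A33 p : A p i3 i3 = 0 by rewrite mxE.
have AE := (A11, A12, A13, A21, A22, A23, A31, A32, A33).
have AF := (funext A11, funext A12, funext A13, funext A21, funext A22,
            funext A23, funext A31, funext A32, funext A33).
have sd i h : smooth h -> smooth (d i h) by exact: smooth_dirder.
have fm0 p : f p * m p != 0 by rewrite mulf_neq0.
have mm0 p : m p * m p != 0 by rewrite mulf_neq0.
have sfm : smooth (fun p => f p * m p) by exact: smoothM.
have smm : smooth (fun p => m p * m p) by exact: smoothM.
have sP : smooth P by apply: smoothB; apply: smooth_div; auto.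
have sQ : smooth Q by apply: smoothN; apply: smooth_div; auto.
have sA i j : smooth (fun p => A p i j).
  have s0 : smooth (fun _ : Sigma => (0 : R)) by exact: smooth_cst.
  have [->|->|->] := ord3P i; have [->|->|->] := ord3P j;
    rewrite AF //.
  - exact: smoothV.
  - exact: smooth_div.
have uA p : A p \in unitmx.
  pose B := mx3 (0 : R) [:: [:: 0; m p / f p; 0]; [:: 0; 0; (f p)^-1];
    [:: m p; - (P p * m p * m p / f p); - (Q p * m p / f p)]].
  suff /mulmx1_unit[] : A p *m B = 1%:M by [].
  apply/matrixP => i j; rewrite mxE sum_ord3.
  have [->|->|->] := ord3P i; rewrite !AE; have [->|->|->] := ord3P j;
    rewrite !mxE /=; field; rewrite ?f0 ?m0 //.
split=> //.
have co : coframing omega by exact: change_coframing.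
have inv3 h : smooth h -> flow_invariant D phi h -> forall p, d i3 h p = 0.
  move=> sh invh p; have cp := chart_atP p.
  have := flow_invariant_dfun flow invh sh cp.
  (* The first dual vector of omega is m times the third one of alpha. *)
  pose v : 'rV[R]_3 := \row_j [:: 0; 0; m p]`_j.
  have [v1 v2 v3] : [/\ v 0 i1 = 0, v 0 i2 = 0 & v 0 i3 = m p] by rewrite !mxE.
  rewrite (@change_dual_frame _ _ A alpha i1 v) //; last first.
    apply/rowP => j; rewrite mxE sum_ord3 v1 v2 v3 !mul0r !add0r [_^T _ _]mxE.
    by have [->|->|->] := ord3P j; rewrite AE mxE /= ?mulr0// divff.
  rewrite sum_ord3 v1 v2 v3 !scale0r !add0r -scalemxAl mxE => /eqP.
  by rewrite mulf_eq0 (negPf (m0 p)) => /eqP.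
have m3 := inv3 m sm invm; have f3 := inv3 f sf invf.
have dP i p : d i P p = d i (d i2 f) p / (f p * m p)
    - d i2 f p * (f p * d i m p + m p * d i f p) / (f p * m p) ^+ 2
    - (d i (d i2 m) p / (m p * m p)
       - d i2 m p * (m p * d i m p + m p * d i m p) / (m p * m p) ^+ 2).
  by rewrite /d dirderB ?dirder_div ?dirderM//; try (apply: smooth_div; auto); auto.
have dQ i p : d i Q p = - (d i (d i1 f) p / (f p * m p)
    - d i1 f p * (f p * d i m p + m p * d i f p) / (f p * m p) ^+ 2).
  by rewrite /d dirderN ?dirder_div ?dirderM//; try (apply: smooth_div; auto); auto.
have dS i p : d i (fun p => (m p)^-1) p = - (m p) ^- 2 * d i m p.
  exact: dirderV.
have dF i p : d i (fun p => f p / m p) p = d i f p / m p - f p * d i m p / m p ^+ 2.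
  exact: dirder_div.
have extE i c p := cartan_extd sa (sA i) (p := p) (c := c).
pose I p := - 2 * d i2 m p / (m p * f p).
exists I, (fun p => m p * m p); split => //.
- apply: smooth_div => //; last by move=> p; rewrite mulrC.
    by apply: smoothM; [exact: smooth_cst|exact: sd].
  exact: smoothM.
have [m31 m32] := all_and2 (cartan_invariant_commutators sa sm m3).
have [f31 f32] := all_and2 (cartan_invariant_commutators sa sf f3).
rewrite -/d in m31 m32 f31 f32.
have wedgeA i j c p := wedge_comb (fun k q => A q i k) (fun k q => A q j k) alpha c p.
split=> c p cp; rewrite /omega /change extE// !AF -/d.
- have -> : d i1 Q p - d i2 P p + Rc p * A p i1 i3
      = f p ^+ 2 / m p - I p * (f p * P p).
    have -> : Rc p = f p ^+ 2 + (Rc p - f p ^+ 2) by rewrite subrKC.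
    by rewrite HR A13 dQ dP; exact: curvature_identity.
  have -> : d i1 (fun q => (m q)^-1) p - d i3 P p - A p i1 i2 = 0.
    by rewrite A12 dS dP f32 m32 m3 f3 /Q; field; rewrite f0 m0.
  have -> : d i2 (fun q => (m q)^-1) p - d i3 Q p + A p i1 i1 = I p * (f p / m p).
    by rewrite A11 dS dQ f31 m3 f3 /P /I; field; rewrite f0 m0.
  rewrite /add2 /opp2 /scale2 !wedgeA !AE.
  move: (wedge _ _ c p) (wedge _ _ c p) (wedge _ _ c p) => W12 W13 W23.
  by apply/matrixP => k l; rewrite !mxE; ring.
- rewrite /opp2 wedgeA !AE /d !dirder_cst -/d !dF m3 f3.
  move: (wedge _ _ c p) (wedge _ _ c p) (wedge _ _ c p) => W12 W13 W23.
  by apply/matrixP => k l; rewrite !mxE /P; field; rewrite f0 m0.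
- rewrite /scale2 wedgeA !AE /d !dirder_cst -/d f3.
  move: (wedge _ _ c p) (wedge _ _ c p) (wedge _ _ c p) => W12 W13 W23.
  by apply/matrixP => k l; rewrite !mxE /Q; field; rewrite f0 m0.
Qed.
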